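(* Let $a,b\in\mathbb{R}$ and consider the difference equation $x_{n+1}=\dfrac{x_{n-1}}{a+bx_nx_{n-1}}$, $n\ge 0$. Let $(x_{-1},x_0)\in\mathbb{R}^2$ be an admissible initial condition and denote $\alpha=bx_{-1}x_0$. Then the corresponding solution is given by $$x_{2k+2}=x_0\prod_{i=0}^k h(2i+1),\qquad x_{2k+1}=x_{-1}\prod_{i=0}^k h(2i)$$ for all integers $k\geq 0$, where $$h(n)=\begin{cases}\dfrac{a^n(1-a)+\alpha(1-a^n)}{a^{n+1}(1-a)+\alpha(1-a^{n+1})} & \text{if } a\neq 1,\\[2mm] \dfrac{1+\alpha n}{1+\alpha(n+1)} & \text{if } a=1.\end{cases}$$
   Context: The pair $(x_{-1},x_0)$, with $\alpha=bx_{-1}x_0$, is an admissible initial condition if either $a=1$ and $\alpha\neq -1/n$ for all integers $n\ge 1$, or $a\ne 1$ and $\alpha\ne a^n(a-1)/(1-a^n)$ for all integers $n\geq 1$ (values of $n$ with $a^n=1$, which occur only for $a=-1$ and $n$ even, impose no restriction). The convention $a^0=1$ is used also when $a=0$. *)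

(* Defs.v *)
From HB Require Import structures.
From mathcomp Require Import all_boot all_order all_algebra.
From mathcomp Require Import reals.

Set Implicit Arguments.
Unset Strict Implicit.
Unset Printing Implicit Defensive.

Import Order.TTheory GRing.Theory Num.Theory.
Local Open Scope ring_scope.

(* Powers [a ^+ n] satisfy [a ^+ 0 = 1] for every [a], including [a = 0]. *)

(* Initial conditions are written [xm1] for x_(-1) and [x0] for x_0. *)
Definition admissible (R : realType) (a b xm1 x0 : R) : Prop :=
  let alpha := b * xm1 * x0 in
  (a = 1 /\ forall n : nat, (1 <= n)%N -> alpha <> - 1 / n%:R)
  \/
  (a <> 1 /\ forall n : nat, (1 <= n)%N -> a ^+ n <> 1 ->
     alpha <> a ^+ n * (a - 1) / (1 - a ^+ n)).

(* Solutions are indexed by [int]; only the values at indices n >= -1 are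
   constrained.  Since division in [R] is total, the denominators are required
   to be nonzero explicitly. *)
Definition is_solution (R : realType) (a b xm1 x0 : R) (x : int -> R) : Prop :=
  [/\ x (- 1) = xm1,
      x 0 = x0
    & forall n : nat,
        a + b * x n%:Z * x (n%:Z - 1) <> 0 /\
        x (n%:Z + 1) = x (n%:Z - 1) / (a + b * x n%:Z * x (n%:Z - 1))].

Definition h_num (R : realType) (a alpha : R) (n : nat) : R :=
  if a == 1 then 1 + alpha * n%:R
  else a ^+ n * (1 - a) + alpha * (1 - a ^+ n).

Definition h_den (R : realType) (a alpha : R) (n : nat) : R :=
  if a == 1 then 1 + alpha * (n + 1)%:R
  else a ^+ (n + 1) * (1 - a) + alpha * (1 - a ^+ (n + 1)).

Definition h (R : realType) (a alpha : R) (n : nat) : R :=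
  h_num a alpha n / h_den a alpha n.

(* Main.v *)
(* Write D n for the numerator of [h n]; the denominator is D (n + 1), and
   D (n + 1) = a D n + alpha D 0.  Along a solution, y_n = b x_n x_(n-1)
   satisfies y_(n+1) = y_n / (a + y_n) with y_0 = alpha, hence
   y_n = alpha D 0 / D n and a + y_n = D (n + 1) / D n.  The equation thus
   becomes the linear recurrence x_(n+1) = x_(n-1) h n, and admissibility says
   exactly that no D n vanishes. *)
Require Import Defs.
From mathcomp Require Import all_boot all_order all_algebra.
From mathcomp Require Import reals.
From mathcomp Require Import ring.

Set Implicit Arguments.
Unset Strict Implicit.
Unset Printing Implicit Defensive.

Import Order.TTheory GRing.Theory Num.Theory.
Local Open Scope ring_scope.

Lemma h_den_num (R : realType) (a alpha : R) n :
  h_den a alpha n = h_num a alpha n.+1.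
Proof. by rewrite /h_den /h_num addn1. Qed.

Lemma h_num_rec (R : realType) (a alpha : R) n :
  h_num a alpha n.+1 = a * h_num a alpha n + alpha * h_num a alpha 0.
Proof.
rewrite /h_num; case: eqVneq => [->|_]; last by rewrite exprS expr0; ring.
by rewrite -natr1; ring.
Qed.

(** If n = 0, or if a ^+ n = 1 with a <> 1, then D n is 1 or 1 - a. In all other cases D n = 0 can
    be solved for alpha and yields exactly the value that admissibility excludes at n. *)
Lemma h_num_neq0 (R : realType) (a b xm1 x0 : R) n :
  admissible a b xm1 x0 -> h_num a (b * xm1 * x0) n != 0.
Proof.
rewrite /admissible /h_num; set alpha := b * xm1 * x0.
case: n => [|n] [[a1 adm]|[/eqP a1 adm]].
- by rewrite a1 eqxx mulr0 addr0 oner_eq0.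
- by rewrite (negbTE a1) expr0 subrr mulr0 addr0 mul1r subr_eq0 eq_sym.
- rewrite a1 eqxx; apply/eqP => D0; apply: (adm n.+1 isT).
  have n0 : n.+1%:R != 0 :> R by rewrite pnatr_eq0.
  apply: (mulIf n0); rewrite divfK //; apply/eqP.
  by rewrite -addr_eq0 addrC D0.
- rewrite (negbTE a1); have [an|an] := eqVneq (a ^+ n.+1) 1.
    by rewrite an subrr mulr0 addr0 mul1r subr_eq0 eq_sym.
  apply/eqP => D0; apply: (adm n.+1 isT); first exact/eqP.
  have an0 : 1 - a ^+ n.+1 != 0 by rewrite subr_eq0 eq_sym.
  apply: (mulIf an0); rewrite divfK //; apply/eqP.
  by rewrite -subr_eq0 -D0; apply/eqP; ring.
Qed.

Section TwoStep.
Variables (R : realType) (a b xm1 x0 : R).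
Hypothesis adm : admissible a b xm1 x0.
Let alpha := b * xm1 * x0.

(** With u, v in the roles of x_n, x_(n-1), the hypothesis is y_n = alpha D 0 / D n cleared of
    division; adding a D n to both sides gives D (n + 1) by [h_num_rec]. *)
Lemma denominator_h_num u v n :
  b * u * v * h_num a alpha n = alpha * h_num a alpha 0 ->
  a + b * u * v = h_num a alpha n.+1 / h_num a alpha n.
Proof.
move=> inv; apply: (mulIf (h_num_neq0 n adm)).
by rewrite divfK ?h_num_neq0 // mulrDl inv h_num_rec.
Qed.

(* The index of [s] is shifted by one: s n stands for x_(n-1). *)
Lemma two_step_invariant (s : nat -> R) n :
  s 0 = xm1 -> s 1 = x0 ->
  (forall m, (m < n)%N -> s m.+2 = s m * h a alpha m) ->
  b * s n.+1 * s n * h_num a alpha n = alpha * h_num a alpha 0.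
Proof.
move=> s0 s1; elim: n => [|n IHn] sS; first by rewrite s0 s1 /alpha; ring.
rewrite -IHn => [|m mn]; last exact: sS (ltnW _).
(* The new factor s n * D n / D (n + 1) meets D (n + 1), so the product is the one at the previous
   index. *)
rewrite sS // /h h_den_num.
by field; exact: h_num_neq0.
Qed.

Lemma solution_two_step x : is_solution a b xm1 x0 x ->
  forall n : nat, x (n%:Z + 1) = x (n%:Z - 1) * h a alpha n.
Proof.
case=> x_m1 x_0 xS n; pose s m := x (m%:Z - 1).
have sP m : s m.+1 = x m by rewrite /s -addn1 PoszD addrK.
(* The invariant at n relies on the two-step relation at every m < n, hence strong induction. *)
elim/ltn_ind: n => n IHn; have [_ ->] := xS n.
have inv : b * x n * x (n%:Z - 1) * h_num a alpha n = alpha * h_num a alpha 0.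
  rewrite -sP; apply: (two_step_invariant (s := s)) => [||m mn].
  - by rewrite /s sub0r.
  - by rewrite sP.
  - by rewrite sP -addn1 PoszD IHn.
by rewrite (denominator_h_num inv) /h h_den_num invf_div.
Qed.

Lemma solution_exists : exists x, is_solution a b xm1 x0 x.
Proof.
(* The two-step recurrence unrolled: it descends through the indices of the parity of n, ending at s
   0 = x_(-1) or s 1 = x_0. *)
pose s n := (if odd n then x0 else xm1) *
  \prod_(0 <= i < n./2) h a alpha (2 * i + odd n).
have s0 : s 0%N = xm1 by rewrite /s big_nil mulr1.
have s1 : s 1%N = x0 by rewrite /s big_nil mulr1.
have sS n : s n.+2 = s n * h a alpha n.
  rewrite /s /= negbK big_nat_recr //= mulrA.
  by rewrite mul2n addnC odd_double_half.
exists (fun i => if i is Posz n then s n.+1 else xm1); split=> // n.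
(* For n = 0 the index is -1, and the [Negz] branch agrees with s 0. *)
have -> : (match n%:Z - 1 with Posz m => s m.+1 | Negz _ => xm1 end) = s n.
  by case: n => [|n] //; rewrite -addn1 PoszD addrK addn1.
have D := denominator_h_num (two_step_invariant s0 s1 (fun m (_ : (m < n)%N) => sS m)).
rewrite -PoszD addn1 D; split; last by rewrite sS /h h_den_num invf_div.
by apply/eqP; rewrite mulf_neq0 ?invr_eq0 ?h_num_neq0.
Qed.

End TwoStep.

Theorem theorem2p6 (R : realType) (a b xm1 x0 : R)
  (hadm : admissible a b xm1 x0) :
  let alpha := b * xm1 * x0 in
  (exists x : int -> R, is_solution a b xm1 x0 x) /\
  (forall n : nat, h_den a alpha n <> 0) /\
  (forall x : int -> R, is_solution a b xm1 x0 x ->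
     forall k : nat,
       x (2 * k + 2)%N%:Z = x0 * \prod_(0 <= i < k.+1) h a alpha (2 * i + 1) /\
       x (2 * k + 1)%N%:Z = xm1 * \prod_(0 <= i < k.+1) h a alpha (2 * i)).
Proof.
move=> alpha; split; first exact: solution_exists.
split=> [n|x sol k]; first by apply/eqP; rewrite h_den_num h_num_neq0.
have xS := solution_two_step hadm sol; case: sol => x_m1 x_0 _.
have xS2 n : x n.+2%:Z = x n * h a alpha n.+1.
  by have := xS n.+1; rewrite -PoszD addn1 -[in X in _ = X]addn1 PoszD addrK addn1.
(* [xS2] only reaches indices from 2 on; x_1 is computed from x_(-1). *)
have x_1 : x 1%N = xm1 * h a alpha 0 by rewrite -x_m1; exact: xS 0%N.
elim: k => [|k [IHe IHo]].
  by rewrite !big_nat1 xS2 x_0 x_1.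
rewrite !(big_nat_recr k.+1) //= (mulrA x0) (mulrA xm1) -IHe -IHo.
have -> : (2 * k.+1 + 2 = (2 * k + 2).+2)%N by rewrite mulnS.
have -> : (2 * k.+1 + 1 = (2 * k + 1).+2)%N by rewrite mulnS.
by rewrite !xS2 mulnS !addn1 addn2.
Qed.
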